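(* Let $X$ be a proper metric space and let a finite group $G$ act on $X$ by coarse maps. Then the quotient map $X\to G\setminus X$, $x\mapsto G\cdot x$, onto the space of orbits equipped with the Hausdorff metric, is coarsely open.
   Context: A metric space is proper if the closure of each bounded set is compact. A map $f\colon X\to Y$ of metric spaces is coarse if preimages of bounded sets are bounded and for each $R>0$ there exists $S>0$ such that $d(x,y)\le R$ implies $d(f(x),f(y))\le S$. $G$ acts by coarse maps if $x\mapsto g\cdot x$ is coarse for each $g\in G$. $G\setminus X$ denotes the set of orbits $\{G\cdot x\}_{x\in X}$ with the Hausdorff distance between orbits (as finite subsets of $X$) as metric. A function $\rho\colon[0,\infty)\to[0,\infty)$ is TI-increasing if it is (not necessarily strictly) increasing and $\lim_{t\to\infty}\rho(t)=\infty$. Each space $Z$ carries a fixed basepoint $z_0$. Let $N(z,R)$ be the closed ball of radius $R$ about $z$. For $A\subset Z$ and TI-increasing $\rho$ put $N(A,\rho)=\bigcup_{z\in A}N\big(z,\rho(d(z,z_0))\big)$. A map $f\colon X\to Y$ is coarsely open if for each unbounded $A\subset X$ and each TI-increasing $\rho$ there exists a TI-increasing $\tilde\rho$ such that $N(f(A),\tilde\rho)\subset f(N(A,\rho))$. *)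

(* Defs.v *)
From HB Require Import structures.
From mathcomp Require Import all_boot all_order all_algebra all_fingroup.
From mathcomp Require Import all_classical all_reals all_analysis.

Set Implicit Arguments.
Unset Strict Implicit.
Unset Printing Implicit Defensive.

Import Order.TTheory GRing.Theory Num.Theory.
Import numFieldNormedType.Exports.

Local Open Scope classical_set_scope.
Local Open Scope ring_scope.

Section CoarseGeometry.
Context {R : realType}.

Definition metric_bounded (X : metricType R) (A : set X) : Prop :=
  exists r : R, forall x y, A x -> A y -> mdist x y <= r.

Definition proper_metric (X : metricType R) : Prop :=
  forall A : set X, metric_bounded A -> compact (closure A).

Definition coarse_map (X Y : metricType R) (f : X -> Y) : Prop :=
  (forall B : set Y, metric_bounded B -> metric_bounded (f @^-1` B)) /\
  (forall r : R, 0 < r -> exists2 s : R, 0 < s &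
     forall x y : X, mdist x y <= r -> mdist (f x) (f y) <= s).

(* A function [0, +oo[ -> [0, +oo[ is represented by a total function R -> R,
   of which only the values at nonnegative arguments matter. *)
Definition TI_increasing (rho : R -> R) : Prop :=
  [/\ forall t, 0 <= t -> 0 <= rho t,
      forall s t, 0 <= s -> s <= t -> rho s <= rho t
    & rho t @[t --> +oo] --> +oo].

(* The set of points at distance at most r; the library's closed_ball is the
   closure of the open ball, which can be smaller. *)
Definition cball (Z : metricType R) (z : Z) (r : R) : set Z :=
  [set y | mdist z y <= r].

Definition TI_nbhd (Z : metricType R) (z0 : Z) (A : set Z) (rho : R -> R) :
    set Z :=
  \bigcup_(z in A) cball z (rho (mdist z z0)).

(* x0 and y0 are the basepoints of X and Y. *)
Definition coarsely_open (X Y : metricType R) (x0 : X) (y0 : Y) (f : X -> Y) :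
    Prop :=
  forall (A : set X) (rho : R -> R),
    ~ metric_bounded A -> TI_increasing rho ->
    exists2 rho' : R -> R, TI_increasing rho' &
      TI_nbhd y0 (f @` A) rho' `<=` f @` TI_nbhd x0 A rho.

Definition set_dist (X : metricType R) (x : X) (B : set X) : R :=
  inf [set mdist x y | y in B].

(* Meaningful for nonempty bounded sets. *)
Definition hausdorff_dist (X : metricType R) (A B : set X) : R :=
  Num.max (sup [set set_dist x B | x in A]) (sup [set set_dist y A | y in B]).

End CoarseGeometry.

(* MathComp's {action gT &-> X} is a right action, and its orbits require X to
   be finite. *)
Record left_action (gT : finGroupType) (X : Type) := LeftAction {
  lact :> gT -> X -> X ;
  lact1 : forall x, lact 1%g x = x ;
  lactM : forall g h x, lact (g * h)%g x = lact g (lact h x) }.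

Definition lorbit (gT : finGroupType) (X : Type) (a : left_action gT X)
    (x : X) : set X :=
  range (fun g => a g x).

Definition orbit_space (gT : finGroupType) (X : Type) (a : left_action gT X) :=
  {A : set X | exists x, A = lorbit a x}.

Definition orbit_proj (gT : finGroupType) (X : Type) (a : left_action gT X)
    (x : X) : orbit_space a :=
  exist _ (lorbit a x) (ex_intro _ x erefl).

HB.instance Definition _ (gT : finGroupType) (X : Type)
  (a : left_action gT X) := gen_eqMixin (orbit_space a).
HB.instance Definition _ (gT : finGroupType) (X : Type)
  (a : left_action gT X) := gen_choiceMixin (orbit_space a).

Section OrbitMetric.
Context {R : realType} {gT : finGroupType} {X : metricType R}.
Variable a : left_action gT X.

Lemma set_dist_lorbitP (x y : X) :
  (exists g, set_dist x (lorbit a y) = mdist x (a g y)) /\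
  (forall g, set_dist x (lorbit a y) <= mdist x (a g y)).
Proof.
have lb g : set_dist x (lorbit a y) <= mdist x (a g y).
  apply: ge_inf; last by exists (a g y) => //; exists g.
  by exists 0 => _ [z _ <-]; exact: mdist_ge0.
split=> //; case: (@Order.TotalTheory.arg_minP _ _ _ (1%g : gT) xpredT
  (fun g => mdist x (a g y)) isT) => g _ gmin.
exists g; apply/eqP; rewrite eq_le lb /=.
apply: lb_le_inf; first by exists (mdist x (a 1%g y)), (a 1%g y) => //; exists 1%g.
by move=> _ [_ [h _ <-] <-]; exact: gmin.
Qed.

Lemma sup_lorbitP (f : X -> R) (x : X) (r : R) :
  sup (f @` lorbit a x) <= r <-> forall g, f (a g x) <= r.
Proof.
have ne : (f @` lorbit a x) !=set0.
  by exists (f (a 1%g x)), (a 1%g x) => //; exists 1%g.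
split=> [le_r g|le_r]; last by apply: ge_sup => // _ [_ [g _ <-] <-].
apply: le_trans le_r; apply: ub_le_sup; last by exists (a g x) => //; exists g.
case: (@Order.TotalTheory.arg_maxP _ _ _ (1%g : gT) xpredT
  (fun g => f (a g x)) isT) => h _ hmax.
by exists (f (a h x)) => _ [_ [k _ <-] <-]; exact: hmax.
Qed.

Lemma hausdorff_dist_lorbitP (x y : X) (r : R) :
  hausdorff_dist (lorbit a x) (lorbit a y) <= r <->
  (forall g, exists h, mdist (a g x) (a h y) <= r) /\
  (forall g, exists h, mdist (a g y) (a h x) <= r).
Proof.
have half u v : sup [set set_dist z (lorbit a v) | z in lorbit a u] <= r <->
    forall g, exists h, mdist (a g u) (a h v) <= r.
  rewrite sup_lorbitP; split=> H g.
    by have [[h hE] _] := set_dist_lorbitP (a g u) v; exists h; rewrite -hE.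
  have [h hr] := H g; apply: le_trans hr.
  by have [_] := set_dist_lorbitP (a g u) v; exact.
rewrite /hausdorff_dist ge_max; split=> [/andP[/half ? /half ?] //|].
by case=> ? ?; apply/andP; split; apply/half.
Qed.

Definition orbit_dist (u v : orbit_space a) : R :=
  hausdorff_dist (sval u) (sval v).

Lemma hausdorff_dist_lorbit_ge0 (x y : X) :
  0 <= hausdorff_dist (lorbit a x) (lorbit a y).
Proof.
have /hausdorff_dist_lorbitP[/(_ 1%g)[h] + _] :=
  lexx (hausdorff_dist (lorbit a x) (lorbit a y)).
by apply: le_trans; exact: mdist_ge0.
Qed.

Lemma orbit_distxx u : orbit_dist u u = 0.
Proof.
case: u => A Ax; rewrite /orbit_dist /=; case: Ax => x ->; apply/eqP.
rewrite eq_le hausdorff_dist_lorbit_ge0 andbT.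
by apply/hausdorff_dist_lorbitP; split=> g; exists g; rewrite mdistxx.
Qed.

Lemma orbit_dist_positivity u v : orbit_dist u v = 0 -> u = v.
Proof.
case: u v => A Ax [B By]; rewrite /orbit_dist /= => d0.
apply: eq_exist; case: Ax By d0 => x -> [y ->] d0.
have /hausdorff_dist_lorbitP[xy yx] :
  hausdorff_dist (lorbit a x) (lorbit a y) <= 0 by rewrite d0.
have half p q : (forall g, exists h, mdist (a g p) (a h q) <= 0) ->
    lorbit a p `<=` lorbit a q.
  move=> pq _ [g _ <-]; have [h h0] := pq g; exists h => //.
  by apply/esym/mdist_positivity/eqP; rewrite eq_le h0 mdist_ge0.
by apply/seteqP; split; exact: half.
Qed.

Lemma orbit_dist_sym u v : orbit_dist u v = orbit_dist v u.
Proof. by rewrite /orbit_dist /hausdorff_dist maxC. Qed.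

Lemma orbit_dist_triangle v u w :
  orbit_dist u w <= orbit_dist u v + orbit_dist v w.
Proof.
case: u v w => A Ax [B By] [C Cz]; rewrite /orbit_dist /=.
case: Ax By Cz => x -> [y ->] [z ->].
have /hausdorff_dist_lorbitP[xy yx] :=
  lexx (hausdorff_dist (lorbit a x) (lorbit a y)).
have /hausdorff_dist_lorbitP[yz zy] :=
  lexx (hausdorff_dist (lorbit a y) (lorbit a z)).
apply/hausdorff_dist_lorbitP; split=> g.
  have [h gh] := xy g; have [k hk] := yz h; exists k.
  by apply: le_trans (metric_triangle _ (a h y) _) _; exact: lerD.
have [h gh] := zy g; have [k hk] := yx h; exists k.
by apply: le_trans (metric_triangle _ (a h y) _) _; rewrite addrC lerD.
Qed.

HB.instance Definition _ := isMetric.Build R (orbit_space a)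
  orbit_distxx orbit_dist_positivity orbit_dist_sym orbit_dist_triangle.

Lemma orbit_mdistE (x y : X) :
  mdist (orbit_proj a x) (orbit_proj a y) =
  hausdorff_dist (lorbit a x) (lorbit a y).
Proof. by []. Qed.

End OrbitMetric.

(* Main.v *)
Require Import Defs.
From mathcomp Require Import all_boot all_order all_algebra all_fingroup.
From mathcomp Require Import all_classical all_reals all_analysis.

(** If the orbit of [w] is within Hausdorff distance [r] of the orbit of [z],
    then some translate of [w] is within [r] of [z] itself.  The image of
    [TI_nbhd x0 A rho] therefore contains [TI_nbhd y0 (orbit_proj a @` A) rho']
    as soon as [rho'], evaluated at the distance from the orbit of [z] to [y0],
    is at most [rho] evaluated at the distance from [z] to [x0].

    Such a [rho'] exists because each element of the group moves points at
    bounded distance from [x0] to points at bounded distance from the image of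
    [x0]; as the group is finite the bound can be taken uniform
    ([orbit_proj_bounded]).  The quotient map thus sends balls to bounded sets,
    so an orbit far from [y0] has all its points far from [x0], where [rho] is
    large.  The infimum of the relevant values of [rho], capped by the identity,
    is then a gauge that still tends to infinity ([TI_increasing_minorant]). *)

Set Implicit Arguments.
Unset Strict Implicit.
Unset Printing Implicit Defensive.

Import Order.TTheory GRing.Theory Num.Theory.
Import numFieldNormedType.Exports.

Local Open Scope classical_set_scope.
Local Open Scope ring_scope.

(** The gauge at [t] is the smaller of [t] and the infimum of [rho (p z)] over
    the [z] with [t <= q z].  Enlarging [t] shrinks this set of [z], whence
    monotonicity; and [p z] is large once [q z] is, by contraposition of the
    second hypothesis, whence divergence. *)
Lemma TI_increasing_minorant (R : realType) (T : Type) (p q : T -> R)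
    (rho : R -> R) :
  (forall z, 0 <= p z) ->
  (forall r, exists s, forall z, p z <= r -> q z <= s) ->
  TI_increasing rho ->
  exists2 rho' : R -> R, TI_increasing rho' &
    forall z, 0 <= q z -> rho' (q z) <= rho (p z).
Proof.
move=> p_ge0 q_ctrl [rho_ge0 rho_mono /cvgryPge rho_oo].
(* The half-line [t, +oo[ is added because [inf set0 = 0]: without it the
   gauge would vanish beyond the supremum of [q] when [q] is bounded. *)
pose V t := [set s | t <= s] `|` [set rho (p z) | z in [set z | t <= q z]].
have V_neq0 t : V t !=set0 by exists t; left => /=.
have V_ge0 t : 0 <= t -> lbound (V t) 0.
  by move=> t0 v [/= /(le_trans t0) //|[z _ <-]]; exact: rho_ge0.
have inf_le t v : 0 <= t -> V t v -> inf (V t) <= v.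
  by move=> t0; apply: ge_inf; exists 0; exact: V_ge0.
exists (fun t => inf (V t)); last first.
  by move=> z qz; apply: inf_le => //; right; exists z => /=.
split=> [t t0|s t s0 st|].
- by apply: lb_le_inf => //; exact: V_ge0.
- apply: lb_le_inf => // v Vtv; apply: inf_le => //.
  case: Vtv => [/= tv|[z /= tz <-]]; first by left; exact: le_trans tv.
  by right; exists z => //=; exact: le_trans tz.
apply/cvgryPge => M.
have [N [_ rho_gt]] := rho_oo M; have [S qS] := q_ctrl (N + 1).
near=> t; apply: lb_le_inf => // v [/= tv|[z /= tz <-]].
  apply: le_trans tv; near: t.
  by apply: nbhs_pinfty_ge; rewrite num_real.
apply: rho_gt; rewrite ltNge; apply/negP => pN.
have qzS : q z <= S by apply: qS; rewrite (le_trans pN)// lerDl.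
have : S < t by near: t; apply: nbhs_pinfty_gt; rewrite num_real.
by rewrite ltNge (le_trans tz qzS).
Unshelve. all: by end_near. Qed.

(** The points [a g x] and [a g x0] match up the orbits of [x] and [x0], so the
    Hausdorff distance between these is at most the largest, over the finite
    group, of the moduli of the maps [a g]. *)
Lemma orbit_proj_bounded (R : realType) (X : metricType R)
    (gT : finGroupType) (a : left_action gT X) (x0 : X) (y0 : orbit_space a) :
  (forall g, coarse_map (a g)) ->
  forall r : R, exists s : R, forall x,
    mdist x x0 <= r -> mdist (orbit_proj a x) y0 <= s.
Proof.
move=> a_coarse r.
(* The modulus of a coarse map is only given at positive radii. *)
have r_gt0 : 0 < Num.max r 1 by rewrite lt_max ltr01 orbT.
have /choice[S aS] (g : gT) : exists s : R, forall x y,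
    mdist x y <= Num.max r 1 -> mdist (a g x) (a g y) <= s.
  by have [_ /(_ _ r_gt0)[s _ sP]] := a_coarse g; exists s.
exists (\big[Num.max/0]_g S g + mdist (orbit_proj a x0) y0) => x xr.
apply: le_trans (metric_triangle _ (orbit_proj a x0) _) _.
rewrite lerD2r orbit_mdistE; apply/hausdorff_dist_lorbitP.
have gxS g : mdist (a g x) (a g x0) <= \big[Num.max/0]_g S g.
  apply: le_trans (aS g _ _ _) (le_bigmax _ _ g).
  by rewrite le_max xr.
by split=> g; exists g => //; rewrite metric_sym.
Qed.

Theorem proposition4p16 (R : realType) (X : metricType R) (gT : finGroupType)
    (a : left_action gT X) (x0 : X) (y0 : orbit_space a) :
  proper_metric X ->
  (forall g : gT, coarse_map (a g)) ->
  coarsely_open x0 y0 (orbit_proj a).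
Proof.
move=> _ a_coarse A rho _ rhoTI.
have [rho' rho'TI rho'_le] := TI_increasing_minorant
  (fun z => mdist_ge0 z x0) (orbit_proj_bounded x0 y0 a_coarse) rhoTI.
exists rho' => // v [_ [z Az <-]]; rewrite /cball /=.
case: v => B Bw zB; have [w Bw'] := Bw; subst B.
have {zB} : mdist (orbit_proj a z) (orbit_proj a w) <= rho (mdist z x0).
  by apply: le_trans (rho'_le z (mdist_ge0 _ _)); exact: zB.
rewrite orbit_mdistE => /hausdorff_dist_lorbitP[/(_ 1%g)[h]].
(* The translate of [w] near [z] itself lies in the neighbourhood of [A] and
   has the same orbit as [w]. *)
rewrite lact1 => zhw _; exists (a h w); first by exists z.
apply: eq_exist; apply/seteqP; split=> _ [g _ <-].
  by exists (g * h)%g => //; rewrite lactM.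
by exists (g * h^-1)%g => //; rewrite -lactM mulgKV.
Qed.
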